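(* Let $\mathcal{M}=(G=(V,E),\{\phi^e\}_{e\in E})$ and $\mathcal{M}'=(G'=(V',E),\{\psi^e\}_{e\in E})$ be two boolean hypergraphical models over a common (index) set of hyperedges $E$, with spin value sets $S$ and $S'$ of common size $q=|S|=|S'|$. Then $$Z(\mathcal{M};\boldsymbol{g})=q^{|V|-|V'|}\,Z(\mathcal{M}';\boldsymbol{g})\qquad\text{for all }\boldsymbol{g}\in\mathbb{C}^{|E|}$$ if and only if $r_{\mathcal{M}}=r_{\mathcal{M}'}$, that is, $r_{\mathcal{M}}(A)=r_{\mathcal{M}'}(A)$ for every $A\subseteq E$.
   Context: A hypergraph $G=(V,E)$ consists of a finite set $V$ of vertices and a finite multiset $E$ of hyperedges, each a finite multiset of elements of $V$ (repeated hyperedges count as distinct elements of $E$). Let $S$ be a finite set with $q=|S|\ge 2$. A hypergraphical model $\mathcal{M}=(G,\{\phi^e\}_{e\in E})$ consists of a hypergraph $G$ and functions $\phi^e\colon S^{V}\to\mathbb{C}$ such that (1) $\phi^e(\boldsymbol{s})=\phi^e(\boldsymbol{s}')$ whenever $\{s_i\}_{i\in e}=\{s'_i\}_{i\in e}$ as multisets, and (2) $\phi^e=\phi^{e'}$ if $e,e'$ are duplicate hyperedges. It is boolean if every $\phi^e$ takes values in $\{0,1\}$. ''Common edge set $E$'' means that the hyperedges of $G$ and of $G'$ are indexed by the same set $E$. Partition function: $Z(\mathcal{M};\boldsymbol{g})=\sum_{\boldsymbol{s}\in S^V}\prod_{e\in E}\exp(g_e\phi^e(\boldsymbol{s}))$.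 Counting function: $R_{\mathcal{M}}(A)=\#\{\boldsymbol{s}\in S^V\mid \phi^e(\boldsymbol{s})=1\ \forall e\in A\}$ for $A\subseteq E$. Rank function: $r_{\mathcal{M}}(A)=|V|-\log_q R_{\mathcal{M}}(A)$ if $R_{\mathcal{M}}(A)>0$, and $r_{\mathcal{M}}(A)=\infty$ otherwise. *)

(* Defs.v *)
From mathcomp Require Import all_boot all_order all_algebra.
From mathcomp Require Import finmap multiset complex.
From mathcomp Require Import reals ereal sequences exp trigo.

Set Implicit Arguments.
Unset Strict Implicit.
Unset Printing Implicit Defensive.

Import Order.TTheory GRing.Theory Num.Theory.
Local Open Scope ring_scope.
Local Open Scope complex_scope.
Local Open Scope mset_scope.

(* The complex exponential, exp (x + iy) = e^x (cos y + i sin y). *)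
Definition cexp (R : realType) (z : R[i]) : R[i] :=
  (expR (complex.Re z))%:C *
    (cos (complex.Im z) +i* sin (complex.Im z)).

Lemma cexpR (R : realType) (x : R) : cexp x%:C = (expR x)%:C.
Proof. by rewrite /cexp /= cos0 sin0 mulr1. Qed.

Lemma cexpD (R : realType) (z w : R[i]) : cexp (z + w) = cexp z * cexp w.
Proof.
rewrite /cexp raddfD [complex.Im _]raddfD /= expRD sinD cosD rmorphM /=.
rewrite [RHS]mulrACA; congr (_ * _).
by rewrite [sin _ * cos _ + _]addrC; simpc.
Qed.

(* A hypergraph on V whose multiset of hyperedges is indexed by E: distinct
   indices may carry the same hyperedge. *)
Definition hypergraph (V E : finType) := E -> {mset V}.

(* The multiset {s_i}_{i \in e} of spins seen by the hyperedge e; here e is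
   enumerated with multiplicity. *)
Definition spins (V S : finType) (e : {mset V}) (s : {ffun V -> S}) : {mset S} :=
  seq_mset [seq s i | i <- enum_mset e].

Record hmodel (R : realType) (V E S : finType) := HModel {
  hgraph : hypergraph V E;
  hphi : E -> {ffun V -> S} -> R[i];
  hphi_spins : forall (e : E) (s s' : {ffun V -> S}),
    spins (hgraph e) s = spins (hgraph e) s' -> hphi e s = hphi e s';
  hphi_dup : forall e e' : E, hgraph e = hgraph e' ->
    forall s : {ffun V -> S}, hphi e s = hphi e' s
}.

Definition boolean_model (R : realType) (V E S : finType)
    (M : hmodel R V E S) : Prop :=
  forall (e : E) (s : {ffun V -> S}), hphi M e s = 0 \/ hphi M e s = 1.

Definition partition_function (R : realType) (V E S : finType)
    (M : hmodel R V E S) (g : E -> R[i]) : R[i] :=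
  \sum_(s : {ffun V -> S}) \prod_(e : E) cexp (g e * hphi M e s).

Definition counting_function (R : realType) (V E S : finType)
    (M : hmodel R V E S) (A : {set E}) : nat :=
  #|[set s : {ffun V -> S} | [forall e in A, hphi M e s == 1]]|.

(* log_q is ln _ / ln q, with q = #|S|. *)
Definition rank_function (R : realType) (V E S : finType)
    (M : hmodel R V E S) (A : {set E}) : \bar R :=
  if (0 < counting_function M A)%N then
    (#|V|%:R - ln (counting_function M A)%:R / ln #|S|%:R)%:E
  else +oo%E.

(* Main.v *)
Require Import Defs.
From mathcomp Require Import all_boot all_order all_algebra.
From mathcomp Require Import complex.
From mathcomp Require Import reals ereal exp.

(** Both sides of the equivalence say that the counting functions are
    proportional, [R_M A * q ^ |V'| = R_M' A * q ^ |V|] for every [A].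

    For the rank functions this is what taking logarithms to base [q] means; the
    value [+oo] marks the zeros of the counting functions, and proportional
    functions vanish together.

    For the partition functions, a boolean [phi] satisfies
    [exp (g * phi) = 1 + [phi = 1] * (exp g - 1)], so expanding the product over
    the hyperedges gives ([partition_function_expansion])

      [Z (M; g) = \sum_A (\prod_(e in A) (exp (g e) - 1)) * R_M A].

    Proportional counting functions therefore have proportional partition
    functions. Conversely [Z] determines the coefficients [R_M A]: with
    [exp (g e) - 1] equal to [1] on a set [B] and to [0] elsewhere, it is the sum
    of [R_M A] over the subsets [A] of [B], and such sums determine their summands
    ([sum_subsets_inj]). Only the real couplings [0] and [ln 2] are used there. *)

Import Order.TTheory GRing.Theory Num.Theory.
Local Open Scope ring_scope.
Local Open Scope complex_scope.

(** The injectivity half of Moebius inversion on the Boolean lattice: all terms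
    but [f B] in the sum over the subsets of [B] are known by induction on
    [#|B|]. *)
Lemma sum_subsets_inj (E : finType) (G : zmodType) (f f' : {set E} -> G) :
  (forall B : {set E},
     \sum_(A : {set E} | A \subset B) f A = \sum_(A : {set E} | A \subset B) f' A) ->
  forall B : {set E}, f B = f' B.
Proof.
move=> sumE B; have [n] := ubnP #|B|.
elim: n B => // n IHn B leBn.
have := sumE B; rewrite (bigD1 B) //= [RHS](bigD1 B) //=.
rewrite (eq_bigr f') => [|A /andP[sAB neAB]]; first by move/addIr.
apply: IHn; apply: leq_trans (ltnSE leBn).
by rewrite proper_card // properEneq neAB.
Qed.

(** The factors of [Z] are affine in the indicator of [phi = 1], and a product of
    indicators over [A] summed over all spin configurations counts those that
    satisfy every constraint in [A]. *)
Lemma partition_function_expansion (R : realType) (V E S : finType)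
    (M : hmodel R V E S) (g : E -> R[i]) :
  boolean_model M ->
  partition_function M g =
    \sum_(A : {set E})
      (\prod_(e in A) (cexp (g e) - 1)) * (counting_function M A)%:R.
Proof.
move=> boolM; rewrite /partition_function.
pose F e (s : {ffun V -> S}) := (hphi M e s == 1)%:R * (cexp (g e) - 1).
have factorE s e : cexp (g e * hphi M e s) = F e s + 1.
  rewrite /F; case: (boolM e s) => ->.
    by rewrite mulr0 cexpR expR0 eq_sym oner_eq0 mul0r add0r.
  by rewrite mulr1 eqxx mul1r subrK.
under eq_bigr => s _ do under eq_bigr => e _ do rewrite factorE.
under eq_bigr => s _ do rewrite bigA_distr.
rewrite exchange_big /=; apply: eq_bigr => A _.
have prodE s : \prod_e (if e \in A then F e s else 1) =
    (\prod_(e in A) (cexp (g e) - 1)) * [forall e in A, hphi M e s == 1]%:R.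
  rewrite -big_mkcond big_split /= mulrC; congr (_ * _).
  case: forall_inP => [phi1 | /forall_inP].
    by rewrite big1 // => e /phi1 ->.
  rewrite negb_forall_in => /exists_inP[e eA /negPf phi0].
  by rewrite (bigD1 e) //= phi0 mul0r.
under eq_bigr => s _ do rewrite prodE.
rewrite -mulr_sumr -natr_sum; congr (_ * _%:R).
by rewrite -big_mkcond sum1_card /counting_function cardsE.
Qed.

(** The coupling [ln 2] makes [exp g - 1] equal to [1], so the expansion reduces
    to an unweighted sum over the subsets of the set carrying that coupling. *)
Lemma partition_function_ln2 (R : realType) (V E S : finType)
    (M : hmodel R V E S) (B : {set E}) :
  boolean_model M ->
  partition_function M (fun e => (if e \in B then ln 2 else 0)%:C) =
    \sum_(A : {set E} | A \subset B) (counting_function M A)%:R.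
Proof.
move=> boolM; rewrite partition_function_expansion // [RHS]big_mkcond.
apply: eq_bigr => A _; have [sAB | /subsetPn[e eA eNB]] := boolP (A \subset B).
  rewrite big1 ?mul1r // => e /(subsetP sAB) ->.
  by rewrite cexpR lnK ?posrE // rmorph_nat mulr2n addrK.
by rewrite (bigD1 e) //= (negPf eNB) cexpR expR0 subrr !mul0r.
Qed.

(** Cross-multiplying keeps the condition in [nat], and there it also covers
    infinite ranks, since a factor [q ^ k] never vanishes. *)
Lemma rank_function_eqP (R : realType) (V V' E S S' : finType) (q : nat)
    (M : hmodel R V E S) (M' : hmodel R V' E S') (A : {set E}) :
  (1 < q)%N -> #|S| = q -> #|S'| = q ->
  rank_function M A = rank_function M' A <->
  (counting_function M A * q ^ #|V'| = counting_function M' A * q ^ #|V|)%N.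
Proof.
move=> q_gt1 cardS cardS'; rewrite /rank_function cardS cardS'.
have qX_gt0 k : (0 < q ^ k)%N by rewrite expn_gt0 (ltnW q_gt1).
set a := counting_function M A; set b := counting_function M' A.
case: (posnP a) => [-> | a_gt0]; case: (posnP b) => [-> | b_gt0].
- by rewrite !mul0n.
- split=> // /esym/eqP.
  by rewrite mul0n muln_eq0 !eqn0Ngt b_gt0 qX_gt0.
- split=> // /eqP.
  by rewrite mul0n muln_eq0 !eqn0Ngt a_gt0 qX_gt0.
have lnq_neq0 : ln q%:R != 0 :> R by rewrite gt_eqF // ln_gt0 // ltr1n.
have lnMX c k : (0 < c)%N ->
    ln (c * q ^ k)%:R = ln c%:R + k%:R * ln q%:R :> R.
  move=> c_gt0; rewrite natrM natrX lnM ?posrE ?exprn_gt0 ?ltr0n ?(ltnW q_gt1) //.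
  by rewrite lnXn ?ltr0n ?(ltnW q_gt1) // mulr_natl.
have clear_denominator (m n x y : R) :
    (m - x / ln q%:R == n - y / ln q%:R) =
    (x + n * ln q%:R == y + m * ln q%:R).
  rewrite -(inj_eq (mulIf lnq_neq0)) !mulrBl !divfK // subr_eq addrAC eq_sym.
  by rewrite subr_eq [n * _ + _]addrC [m * _ + _]addrC.
split=> [[/eqP] | eq_ab].
  rewrite clear_denominator -!lnMX // => /eqP/ln_inj /eqP.
  by rewrite !posrE !ltr0n !muln_gt0 a_gt0 b_gt0 !qX_gt0 eqr_nat => /(_ isT isT)/eqP.
by congr _%:E; apply/eqP; rewrite clear_denominator -!lnMX // eq_ab.
Qed.

Theorem corollary3p5 (R : realType) (V V' E S S' : finType) (q : nat)
    (hq : (2 <= q)%N) (hS : #|S| = q) (hS' : #|S'| = q)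
    (M : hmodel R V E S) (M' : hmodel R V' E S')
    (hM : boolean_model M) (hM' : boolean_model M') :
  (forall g : E -> R[i],
     partition_function M g =
       q%:R ^ (#|V|%:Z - #|V'|%:Z) * partition_function M' g)
  <->
  (forall A : {set E}, rank_function M A = rank_function M' A).
Proof.
have q_neq0 : q%:R != 0 :> R[i] by rewrite pnatr_eq0 -lt0n (ltnW hq).
have countingE A :
    (counting_function M A)%:R =
      q%:R ^ (#|V|%:Z - #|V'|%:Z) * (counting_function M' A)%:R :> R[i] <->
    (counting_function M A * q ^ #|V'| = counting_function M' A * q ^ #|V|)%N.
  rewrite expfzDr // -invr_expz -!exprnP mulrAC.
  split=> [/(congr1 ( *%R^~ (q%:R ^+ #|V'|))) | eq_ab].
    rewrite divfK ?expf_neq0 // -!natrX -!natrM => /eqP.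
    by rewrite eqr_nat => /eqP ->; rewrite mulnC.
  apply: (mulIf (expf_neq0 #|V'| q_neq0)); rewrite divfK ?expf_neq0 //.
  by rewrite -!natrX -!natrM eq_ab mulnC.
split=> [eqZ A | eqr g].
  apply/(@rank_function_eqP _ _ _ _ _ _ q) => //; apply/countingE.
  apply: (@sum_subsets_inj _ _ (fun A => (counting_function M A)%:R)
    (fun A => _ * (counting_function M' A)%:R)) => B.
  by rewrite -mulr_sumr -!partition_function_ln2.
rewrite !partition_function_expansion // mulr_sumr; apply: eq_bigr => A _.
rewrite [RHS]mulrCA; congr (_ * _); apply/countingE.
exact/(rank_function_eqP _ _ _ _ _ _ q).
Qed.
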